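(* Let $G$ be a baseline cdf and let $a,b,m,n>0$. The $BKw\text{-}G$ family contains the following families as special cases, for all $t>0$: (i) for $n=1$ it reduces to the Garhy generated family: $F^{BKwG}(t;a,b,m,1)=\left[1-[1-G(t)^a]^b\right]^m$; (ii) for $m=n=1$ it reduces to the Kumaraswamy-$G$ family: $F^{BKwG}(t;a,b,1,1)=1-[1-G(t)^a]^b$; (iii) for $a=b=1$ it reduces to the beta-$G$ family: $F^{BKwG}(t;1,1,m,n)=I_{G(t)}(m,n)$.
   Context: $G$ is the cdf of an absolutely continuous distribution on $(0,\infty)$. $B(m,n)$ is the beta function and $I_x(m,n)=B(m,n)^{-1}\int_0^x v^{m-1}(1-v)^{n-1}\,dv$. The Beta Kumaraswamy-$G$ ($BKw\text{-}G$) distribution with parameters $a,b,m,n>0$ has cdf $F^{BKwG}(t;a,b,m,n)=I_{1-[1-G(t)^a]^b}(m,n)$. The Garhy generated family with parameters $\alpha,\beta,\gamma>0$ has cdf $\left[1-[1-G(t)^\alpha]^\beta\right]^\gamma$; the Kumaraswamy-$G$ family with parameters $a,b>0$ has cdf $1-[1-G(t)^a]^b$; the beta-$G$ family with parameters $m,n>0$ has cdf $I_{G(t)}(m,n)$. *)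

(* Defs.v *)
From HB Require Import structures.
From mathcomp Require Import all_boot all_order all_algebra.
From mathcomp Require Import all_classical all_reals all_analysis.

Set Implicit Arguments.
Unset Strict Implicit.
Unset Printing Implicit Defensive.

Import Order.TTheory GRing.Theory Num.Theory.
Import numFieldNormedType.Exports.
Local Open Scope classical_set_scope.
Local Open Scope ring_scope.

Definition baseline_cdf (R : realType) (G : R -> R) : Prop :=
  exists (d : measure_display) (T : measurableType d) (P : probability T R)
         (X : {RV P >-> R}),
    [/\ distribution P X `<< (@lebesgue_measure R),
        distribution P X `]0, +oo[ = 1%E
      & forall t : R, (G t)%:E = cdf X t].

(* For p < 1 the convention 0 `^ (p - 1) = 0 makes the integrand vanish at a
   singular endpoint; this changes it on a null set only. *)
Definition incomplete_beta (R : realType) (x m n : R) : R :=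
  \int[@lebesgue_measure R]_(v in `[0, x])
     (v `^ (m - 1) * (1 - v) `^ (n - 1)).

(* The library's beta_fun only takes natural number parameters. *)
Definition real_beta (R : realType) (m n : R) : R := incomplete_beta 1 m n.

(* I_x(m, n), for x in [0, 1] *)
Definition beta_ratio (R : realType) (x m n : R) : R :=
  (real_beta m n)^-1 * incomplete_beta x m n.

Definition BKwG_cdf (R : realType) (G : R -> R) (a b m n t : R) : R :=
  beta_ratio (1 - (1 - G t `^ a) `^ b) m n.

Definition garhy_cdf (R : realType) (G : R -> R) (alpha beta gamma t : R) : R :=
  (1 - (1 - G t `^ alpha) `^ beta) `^ gamma.

Definition kumaraswamyG_cdf (R : realType) (G : R -> R) (a b t : R) : R :=
  1 - (1 - G t `^ a) `^ b.

Definition betaG_cdf (R : realType) (G : R -> R) (m n t : R) : R :=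
  beta_ratio (G t) m n.

(* Main.v *)
Require Import Defs.
From mathcomp Require Import all_boot all_order all_algebra.
From mathcomp Require Import all_classical all_reals all_analysis.
From mathcomp Require Import measurable_realfun.

Import Order.TTheory GRing.Theory Num.Theory.
Import numFieldNormedType.Exports.
Local Open Scope classical_set_scope.
Local Open Scope ring_scope.

(** The Garhy and Kumaraswamy cases come from the single formula
    [I_x(m, 1) = x `^ m] for [0 <= x] ([beta_ratio1]).  It rests on the
    evaluation of the integral of [v `^ (m - 1)] from [0] to [x] as
    [x `^ m / m] ([integral_powR0]), which is improper at [0] when [m < 1]:
    the fundamental theorem of calculus applies only on the segments from
    [e > 0] to [x], and monotone convergence lets [e] tend to [0].  Taking
    [x = 1] gives the normalising constant [B(m, 1) = 1 / m].

    The Garhy case is this formula at [x = 1 - (1 - G t `^ a) `^ b], which is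
    nonnegative because a cdf takes its values between [0] and [1]; the
    Kumaraswamy case is the same with [m = 1].  The beta case needs no
    integration: for [0 <= G t <= 1] the argument [1 - (1 - G t `^ 1) `^ 1] is
    [G t] itself. *)

Lemma derive1_powR_div (R : realType) (m x : R) : 0 < m -> 0 < x ->
  is_derive x 1 (fun v : R => v `^ m / m) (x `^ (m - 1)).
Proof.
move=> m0 x0; have m_neq0 : m != 0 by rewrite gt_eqF.
have -> : (fun v : R => v `^ m / m) = m^-1 \*: (fun v : R => v `^ m).
  by apply/funext => v /=; rewrite mulrC.
have := @is_deriveZ _ _ _ _ m^-1 _ _ _ (@is_derive1_powR R m x x0).
by rewrite /GRing.scale/= mulrA mulVf// mul1r.
Qed.

(** Away from [0] the power is smooth for every exponent, so the fundamental
    theorem of calculus applies directly. *)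
Lemma integral_powR_segment (R : realType) (m e x : R) :
  0 < m -> 0 < e -> e < x ->
  (\int[@lebesgue_measure R]_(v in `[e, x]) (v `^ (m - 1))%:E =
   (x `^ m / m)%:E - (e `^ m / m)%:E)%E.
Proof.
move=> m0 e0 ex.
have gt0 v : v \in `[e, x] -> 0 < v.
  by rewrite in_itv/= => /andP[ev _]; exact: lt_le_trans ev.
have dF v : v \in `[e, x] -> derivable (fun v : R => v `^ m / m) v 1.
  by move=> /gt0 v0; have [] := derive1_powR_div R m v m0 v0.
apply: (continuous_FTC2 (F := fun v : R => v `^ m / m) ex).
- apply: derivable_within_continuous => v /gt0 v0.
  by apply: derivable_powR; rewrite in_itv/= v0.
- have /(derivable_within_continuous)/(continuous_within_itvP _ ex)[_ Fe Fx] := dF.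
  by split=> // v /subset_itv_oo_cc; exact: dF.
- move=> v /subset_itv_oo_cc/gt0 v0.
  by rewrite derive1E; have /@derive_val := derive1_powR_div R m v m0 v0.
Qed.

(** The integrand is nonnegative and the segments increase to the half-open
    interval from [0] to [x], so monotone convergence passes to the limit
    without prior knowledge of integrability; the missing endpoint [0] is a
    null set. *)
Lemma integral_powR0 (R : realType) (m x : R) : 0 < m -> 0 <= x ->
  (\int[@lebesgue_measure R]_(v in `[0%R, x]) (v `^ (m - 1))%:E =
   (x `^ m / m)%:E)%E.
Proof.
move=> m0; rewrite le_eqVlt => /predU1P[<-|x0].
  by rewrite set_itv1 integral_set1 powR0 ?gt_eqF// mul0r.
have mpow (D : set R) : measurable_fun D (EFin \o (fun v : R => v `^ (m - 1))).
  by apply/measurable_EFinP; apply: measurable_funTS; exact: measurable_powR.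
rewrite -integral_itv_obnd_cbnd//.
(* The denominator starts at [2] to keep every segment nondegenerate. *)
pose e k : R := x / k.+2%:R.
have e0 k : 0 < e k by rewrite divr_gt0.
have ex k : e k < x by rewrite ltr_pdivrMr// ltr_pMr// ltr1n.
have e_cvg : e k @[k --> \oo] --> 0.
  rewrite -(mulr0 x); apply: cvgM; first exact: cvg_cst.
  by have := @cvg_harmonic R; rewrite -(cvg_shiftS (@harmonic R)).
have -> : `]0, x]%classic = \bigcup_k `[e k, x]%classic.
  apply/seteqP; split => v /=; rewrite in_itv/=.
    move=> /andP[v0 vx].
    have : \forall k \near \oo, e k <= v.
      exact: (cvgr_le _ e_cvg).
    by move=> [k _ /(_ k (leqnn k)) ekv]; exists k => //=; rewrite in_itv/= ekv.
  by move=> [k _] /=; rewrite in_itv/= => /andP[/(lt_le_trans (e0 k)) -> ->].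
have int_cvg : (\int[@lebesgue_measure R]_(v in `[e k, x]) (v `^ (m - 1))%:E
    @[k --> \oo] --> \int[@lebesgue_measure R]_(v in \bigcup_k `[e k, x]%classic)
      (v `^ (m - 1))%:E)%E.
  apply: ge0_nondecreasing_set_cvg_integral => //.
  - apply/nondecreasing_seqP => k; apply/subsetPset; apply: subset_itvr.
    by rewrite bnd_simp ler_pM2l// lef_pV2 ?posrE// ler_nat.
  - by move=> k; exact: mpow.
  - by move=> k v _; rewrite lee_fin powR_ge0.
have seg_cvg : (((x `^ m / m)%:E - (e k `^ m / m)%:E)
    @[k --> \oo] --> (x `^ m / m)%:E)%E.
  rewrite -[X in _ --> X]sube0; apply: cvgeB => //; first exact: cvg_cst.
  apply: cvg_EFin; first exact: nearW.
  rewrite -(mul0r m^-1); apply: cvgM; last exact: cvg_cst.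
  by have /cvg_at_rightP := powR_cvg0 m0; apply; split.
have segE : (fun k => \int[@lebesgue_measure R]_(v in `[e k, x])
    (v `^ (m - 1))%:E)%E = (fun k => (x `^ m / m)%:E - (e k `^ m / m)%:E)%E.
  by apply/funext => k; exact: integral_powR_segment.
by move: int_cvg; rewrite segE => /cvg_unique; apply.
Qed.

Lemma incomplete_beta1 (R : realType) (x m : R) : 0 < m -> 0 <= x ->
  incomplete_beta x m 1 = x `^ m / m.
Proof.
move=> m0 x0; rewrite /incomplete_beta /Rintegral.
under eq_integral do rewrite subrr powRr0 mulr1.
by rewrite integral_powR0.
Qed.

Lemma beta_ratio1 (R : realType) (x m : R) : 0 < m -> 0 <= x ->
  beta_ratio x m 1 = x `^ m.
Proof.
move=> m0 x0; rewrite /beta_ratio /real_beta !incomplete_beta1//.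
by rewrite powR1 div1r invrK mulrC divfK// gt_eqF.
Qed.

Lemma baseline_cdf_itv01 (R : realType) (G : R -> R) (t : R) :
  baseline_cdf G -> 0 <= G t <= 1.
Proof.
move=> [d [T [P [X [_ _ GX]]]]].
by rewrite -!lee_fin GX cdf_ge0 cdf_le1.
Qed.

Lemma powR_itv01 (R : realType) (x p : R) :
  0 < p -> 0 <= x <= 1 -> 0 <= x `^ p <= 1.
Proof.
move=> p0 /andP[x0 x1]; rewrite powR_ge0/=.
have <- : 1 `^ p = 1 :> R by rewrite powR1.
by rewrite ge0_ler_powR ?nnegrE// ltW.
Qed.

Lemma onem_itv01 (R : realType) (x : R) : 0 <= x <= 1 -> 0 <= 1 - x <= 1.
Proof. by move=> /andP[x0 x1]; rewrite subr_ge0 x1 gerBl. Qed.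

Lemma kumaraswamyG_cdf_ge0 (R : realType) (G : R -> R) (a b t : R) :
  0 < a -> 0 < b -> baseline_cdf G -> 0 <= kumaraswamyG_cdf G a b t.
Proof.
move=> a0 b0 hG.
suff /andP[] : 0 <= kumaraswamyG_cdf G a b t <= 1 by [].
apply/onem_itv01/powR_itv01 => //; apply/onem_itv01/powR_itv01 => //.
exact: baseline_cdf_itv01.
Qed.

Theorem mainTheorem13 (R : realType) (G : R -> R) (hG : baseline_cdf G)
    (a b m n : R) (ha : 0 < a) (hb : 0 < b) (hm : 0 < m) (hn : 0 < n) :
  [/\ forall t : R, 0 < t -> BKwG_cdf G a b m 1 t = garhy_cdf G a b m t,
      forall t : R, 0 < t -> BKwG_cdf G a b 1 1 t = kumaraswamyG_cdf G a b t
    & forall t : R, 0 < t -> BKwG_cdf G 1 1 m n t = betaG_cdf G m n t].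
Proof.
have Kw_ge0 t := kumaraswamyG_cdf_ge0 R G a b t ha hb hG.
split=> t _.
- exact: beta_ratio1 _ _ _ hm (Kw_ge0 t).
- by rewrite [LHS](beta_ratio1 _ _ _ ltr01 (Kw_ge0 t)) powRr1 ?Kw_ge0.
- have /andP[G0 G1] := baseline_cdf_itv01 R G t hG.
  by rewrite /BKwG_cdf !powRr1 ?subr_ge0 ?powRr1// subKr.
Qed.
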